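(* Let $a\in Ag$, let $\chi,\lambda$ be propositional formulas and let $\varphi,\psi\in\mathcal{L}^{\div}$. The following formulas are valid in $\mathsf{HPAL}$ (i.e. in the class of all Kripke models): 1. (Propositional Inclusion) $[\div\varphi]B_a\chi\to B_a\chi$. 2. (Propositional Conjunctive Inclusion) $[\div(\lambda\wedge\psi)]\neg B_a\lambda\to([\div(\lambda\wedge\psi)]B_a\chi\to[\div\lambda]B_a\chi)$. 3. (Propositional Conjunctive Overlap) $([\div\varphi]B_a\chi\wedge[\div\psi]B_a\chi)\to[\div(\varphi\wedge\psi)]B_a\chi$.
   Context: Language. $At$ is a countable set of atoms, $Ag$ a finite set of agents. The contraction language $\mathcal{L}^{\div}$ is given by $\varphi::=\top\mid p\mid\neg\varphi\mid\varphi\wedge\varphi\mid B_a\varphi\mid[\div\varphi]\varphi\mid\forall\varphi$ with $p\in At$, $a\in Ag$; the other Boolean connectives are the usual abbreviations. A formula is propositional if it is built from $\top$ and atoms using Boolean connectives only. Semantics. A Kripke model is $\mathcal{M}=(W,R,V)$ with $W\neq\emptyset$, $R_a\subseteq W\times W$ an arbitrary relation for each $a\in Ag$, $V:At\to\wp(W)$; $R_a(w)=\{v:(w,v)\in R_a\}$. Atoms and Booleans are standard; $\mathcal{M},w\vDash B_a\varphi$ iff $\mathcal{M},v\vDash\varphi$ for all $v\in R_a(w)$; $\mathcal{M},w\vDash\forall\varphi$ iff $\mathcal{M},v\vDash\varphi$ for all $v\in W$; $\mathcal{M},w\vDash[\div\varphi]\psi$ iff $\mathcal{M}^{\div\varphi},w\vDash\psi$,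 where $\mathcal{M}^{\div\varphi}=(W,R^{\div\varphi},V)$ with $R_a^{\div\varphi}(w)=R_a(w)\cup\{v\in W:\mathcal{M},v\vDash\neg\varphi\}$ if $\mathcal{M},w\vDash B_a\varphi$, and $R_a^{\div\varphi}(w)=R_a(w)$ otherwise. A formula is valid in a class of models if it is true at every world of every model in the class. *)

(* Defs.v *)
From HB Require Import structures.
From mathcomp Require Import all_boot.
From mathcomp Require Import boolp classical_sets.

Set Implicit Arguments.
Unset Strict Implicit.
Unset Printing Implicit Defensive.

Local Open Scope classical_set_scope.

(* [FContr phi psi] is [\div phi] psi, and [FAll phi] is the global modality
   applied to phi. *)
Inductive form (At : countType) (Ag : finType) : Type :=
| FTop
| FAtom of At
| FNot of form At Ag
| FAnd of form At Ag & form At Ag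
| FBel of Ag & form At Ag
| FContr of form At Ag & form At Ag
| FAll of form At Ag.

Arguments FTop {At Ag}.
Arguments FAtom {At Ag}.

Definition FImp (At : countType) (Ag : finType) (phi psi : form At Ag) :
    form At Ag :=
  FNot (FAnd phi (FNot psi)).

Fixpoint propositional (At : countType) (Ag : finType) (phi : form At Ag) :
    bool :=
  match phi with
  | FTop | FAtom _ => true
  | FNot phi1 => propositional phi1
  | FAnd phi1 phi2 => propositional phi1 && propositional phi2
  | FBel _ _ | FContr _ _ | FAll _ => false
  end.

(* [acc a w] is the set R_a(w) of a-successors of w. *)
Record kripke_model (At : countType) (Ag : finType) : Type := KripkeModel {
  world :> Type;
  world_inhabited : inhabited world;
  acc : Ag -> world -> set world;
  val : At -> set world
}.

Definition believes (At : countType) (Ag : finType) (M : kripke_model At Ag)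
    (a : Ag) (X : set M) : set M :=
  [set w | acc a w `<=` X].

(* The contraction of M by a formula depends on the formula only through its
   truth set X, so it is defined for an arbitrary set X of worlds; this lets
   [sat] below be a structural recursion on formulas. *)
Definition contract (At : countType) (Ag : finType) (M : kripke_model At Ag)
    (X : set M) : kripke_model At Ag :=
  @KripkeModel At Ag M (world_inhabited M)
    (fun a w => if `[< believes a X w >] then acc a w `|` ~` X else acc a w)
    (@val At Ag M).

Fixpoint sat (At : countType) (Ag : finType) (phi : form At Ag) :
    forall M : kripke_model At Ag, set M :=
  match phi with
  | FTop => fun M => [set: M]
  | FAtom p => fun M => val p
  | FNot phi1 => fun M => ~` sat (M := M) phi1
  | FAnd phi1 phi2 => fun M => sat (M := M) phi1 `&` sat (M := M) phi2
  | FBel a phi1 => fun M => believes a (sat (M := M) phi1)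
  | FContr phi1 phi2 => fun M => sat (M := contract (sat (M := M) phi1)) phi2
  | FAll phi1 => fun M => [set w | forall v : M, sat phi1 v]
  end.

Definition valid_in (At : countType) (Ag : finType)
    (C : set (kripke_model At Ag)) (phi : form At Ag) : Prop :=
  forall M : kripke_model At Ag, C M -> forall w : M, sat phi w.

Definition HPAL (At : countType) (Ag : finType) : set (kripke_model At Ag) :=
  [set: kripke_model At Ag].

Arguments HPAL {At Ag}.

(* Main.v *)
(* Propositional formulas keep their truth set under contraction, so belief in
   chi after contracting by phi amounts to prior belief in chi, together with
   "every non-phi world is a chi world" whenever phi was believed. The three
   claims are then inclusions between truth sets; in the second one, the loss
   of the belief in lambda forces lambda /\ psi to have been believed whenever
   lambda was. *)
Require Import Defs.
From mathcomp Require Import all_boot.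
From mathcomp Require Import boolp classical_sets.

Local Open Scope classical_set_scope.

Lemma sat_FImp (At : countType) (Ag : finType) (M : kripke_model At Ag)
    (phi psi : form At Ag) (w : M) :
  sat (FImp phi psi) w <-> (sat phi w -> sat psi w).
Proof.
split=> [h hphi|h [hphi]]; last by apply; exact: h.
by apply: contrapT => hpsi; apply: h; split.
Qed.

(** Contraction alters only [acc], while a propositional formula consults only [val]. The two truth
    sets can be equated because [contract X] has the same worlds as [M] by conversion. *)
Lemma sat_contract_propositional (At : countType) (Ag : finType)
    (M : kripke_model At Ag) (X : set M) (chi : form At Ag) :
  propositional chi -> @sat At Ag chi (contract X) = @sat At Ag chi M.
Proof.
elim: chi => //= [phi IH /IH -> //|phi IHphi psi IHpsi].
by case/andP=> /IHphi -> /IHpsi ->.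
Qed.

Lemma believes_contract (At : countType) (Ag : finType)
    (M : kripke_model At Ag) (X Y : set M) (a : Ag) (w : M) :
  @believes At Ag (contract X) a Y w <->
  believes a Y w /\ (believes a X w -> ~` X `<=` Y).
Proof.
rewrite /believes /=; case: asboolP => hX; last by split=> [|[]].
by rewrite subUset; split=> -[hY hXY]; split=> //; exact: hXY.
Qed.

Lemma believesI (At : countType) (Ag : finType) (M : kripke_model At Ag)
    (X Y : set M) (a : Ag) (w : M) :
  believes a (X `&` Y) w <-> believes a X w /\ believes a Y w.
Proof. by rewrite /believes /= subsetI. Qed.

Lemma sat_contract_believes (At : countType) (Ag : finType)
    (M : kripke_model At Ag) (phi chi : form At Ag) (a : Ag) (w : M) :
  propositional chi ->
  sat (FContr phi (FBel a chi)) w <->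
  believes a (@sat At Ag chi M) w /\
  (believes a (@sat At Ag phi M) w ->
   ~` @sat At Ag phi M `<=` @sat At Ag chi M).
Proof.
by move=> chi_prop /=; rewrite sat_contract_propositional // believes_contract.
Qed.

Theorem proposition6p3 (At : countType) (Ag : finType) (a : Ag)
    (chi lambda phi psi : form At Ag)
    (chi_prop : propositional chi) (lambda_prop : propositional lambda) :
  [/\ valid_in HPAL
        (FImp (FContr phi (FBel a chi)) (FBel a chi)),
      valid_in HPAL
        (FImp (FContr (FAnd lambda psi) (FNot (FBel a lambda)))
              (FImp (FContr (FAnd lambda psi) (FBel a chi))
                    (FContr lambda (FBel a chi))))
    & valid_in HPAL
        (FImp (FAnd (FContr phi (FBel a chi)) (FContr psi (FBel a chi)))
              (FContr (FAnd phi psi) (FBel a chi)))].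
Proof.
split=> M _ w.
- by apply/sat_FImp => /(sat_contract_believes _ _ _ _ _ _ _ chi_prop)[].
- apply/sat_FImp => not_lambda; apply/sat_FImp.
  move=> /(sat_contract_believes _ _ _ _ _ _ _ chi_prop)[chiw hchi].
  apply/(sat_contract_believes _ _ _ _ _ _ _ chi_prop); split=> // lambdaw.
  have conjw : believes a (@sat At Ag (FAnd lambda psi) M) w.
    (* If the conjunction were not believed at [w], contraction would add no successors there, so
       the belief in [lambda] would survive. *)
    apply: contrapT => nconjw; apply: not_lambda.
    by apply: (iffRL (sat_contract_believes _ _ _ (FAnd lambda psi) _ _ _
      lambda_prop)); split.
  (* Worlds refuting [lambda] also refute the conjunction, and [hchi] makes all of the latter [chi]
     worlds. *)
  by apply: subset_trans (hchi conjw); apply: subsetC => v [].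
- apply/sat_FImp => -[].
  move=> /(sat_contract_believes _ _ _ _ _ _ _ chi_prop)[chiw hphi].
  move=> /(sat_contract_believes _ _ _ _ _ _ _ chi_prop)[_ hpsi].
  apply/(sat_contract_believes _ _ _ _ _ _ _ chi_prop); split=> //.
  move=> /believesI[/hphi phichi /hpsi psichi].
  (* By De Morgan, a world refuting the conjunction refutes [phi] or [psi]. *)
  by rewrite /= setCI subUset.
Qed.
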